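(* Let $n$ be a positive integer and assume hypothesis $(\star)$ for $\mathbb{R}^n$: for every family $\mathcal{F}$ of closed Lebesgue-null subsets of $\mathbb{R}^n$ with $|\mathcal{F}|<\mathfrak{c}$ and every Lebesgue-null set $N\subset\mathbb{R}^n$, one has $N\cup\bigcup\mathcal{F}\neq\mathbb{R}^n$. (In particular this holds under the Continuum Hypothesis.) Then there exists a set $A\subset\mathbb{R}^n$ that is not Lebesgue null such that for every continuous function $f:\mathbb{R}^n\to\mathbb{R}$ the set $f(A)$ contains no non-degenerate interval.
   Context: $\mathfrak{c}$ denotes the cardinality of the continuum. *)

(* Defs.v *)
From Stdlib Require Import Reals Lra Lia Classical.
From Stdlib Require Fin.
Open Scope R_scope.

Definition Rn (n : nat) := Fin.t n -> R.

Fixpoint fprod (n : nat) : (Fin.t n -> R) -> R :=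
  match n with
  | O => fun _ => 1
  | S m => fun g => g Fin.F1 * fprod m (fun i => g (Fin.FS i))
  end.

Definition box_vol {n : nat} (a b : Rn n) : R := fprod n (fun i => b i - a i).

Definition in_box {n : nat} (a b x : Rn n) : Prop :=
  forall i, a i <= x i <= b i.

Definition lebesgue_null {n : nat} (N : Rn n -> Prop) : Prop :=
  forall eps : R, 0 < eps ->
    exists a b : nat -> Rn n,
      (forall k i, a k i <= b k i) /\
      (forall x, N x -> exists k, in_box (a k) (b k) x) /\
      (forall m, sum_f_R0 (fun k => box_vol (a k) (b k)) m <= eps).

(* closed subset of R^n (product / Euclidean topology, via sup-norm balls) *)
Definition closed_set {n : nat} (C : Rn n -> Prop) : Prop :=
  forall x, ~ C x -> exists r, 0 < r /\
    forall y, (forall i, Rabs (y i - x i) < r) -> ~ C y.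

Definition continuous_Rn {n : nat} (f : Rn n -> R) : Prop :=
  forall x eps, 0 < eps -> exists delta, 0 < delta /\
    forall y, (forall i, Rabs (y i - x i) < delta) -> Rabs (f y - f x) < eps.

Definition card_lt_continuum {T : Type} (F : T -> Prop) : Prop :=
  (exists g : {S : T | F S} -> R, forall u v, g u = g v -> u = v) /\
  ~ (exists h : R -> {S : T | F S}, forall x y, h x = h y -> x = y).

Definition star_hyp (n : nat) : Prop :=
  forall (F : (Rn n -> Prop) -> Prop) (N : Rn n -> Prop),
    (forall S, F S -> closed_set S /\ lebesgue_null S) ->
    card_lt_continuum F ->
    lebesgue_null N ->
    exists x : Rn n, ~ N x /\ forall S, F S -> ~ S x.

Definition image_contains_interval {n : nat} (f : Rn n -> R) (A : Rn n -> Prop) : Prop :=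
  exists a b : R, a < b /\ forall y, a <= y <= b -> exists x, A x /\ f x = y.

(* Main.v *)
Require Import Defs.
From Stdlib Require Import Reals Lra Lia List Cantor FinFun Wellfounded Wf_nat.
From Stdlib Require Import Classical ClassicalEpsilon FunctionalExtensionality.
From Stdlib Require Fin.
From mathcomp Require eqtype boolp wochoice.
From Coquelicot Require Compactness.
Open Scope R_scope.

(** For a continuous [f], the level sets meeting a cube are separated by a fine
    enough grid, so only countably many of them fail to be null.  List all
    triples (continuous [f], interval [[p, q]], null set [N] of the form
    "intersection of box covers") in order type of the continuum.  At step
    [alpha], pick by the hypothesis a point [a_alpha] outside [N_alpha] and
    outside the null level sets [f_beta = y_beta] for [beta < alpha]; then pick
    [y_alpha] in [[p_alpha, q_alpha]] whose [f_alpha]-level set is null and avoids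
    all [a_beta], [beta <= alpha].  The set of the [a_alpha] is not null, and
    [f_alpha] never takes the value [y_alpha] on it.  Cantor space [nat -> bool]
    serves as the index set of size continuum. *)

Definition inj {A B : Type} (h : A -> B) : Prop := forall x y, h x = h y -> x = y.
Definition surj {A B : Type} (h : A -> B) : Prop := forall y, exists x, h x = y.

Definition K := nat -> bool.

(** * Well-orders *)

(** Zermelo's theorem supplies a Boolean relation for which every nonempty subset has a unique
    minimum; its strict part is the order wanted here. *)
Lemma exists_well_order (T : Type) : exists lt : T -> T -> Prop,
  well_founded lt /\ (forall x y, lt x y \/ x = y \/ lt y x).
Proof.
  destruct (wochoice.well_ordering_principle
    (eqtype.Equality.Pack (eqtype.Equality.Class (boolp.gen_eqMixin T)))) as [r Hr].
  assert (Hmin : forall P : T -> Prop, (exists x, P x) ->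
      exists z, P z /\ (forall x, P x -> r z x = true) /\
        forall z', P z' -> (forall x, P x -> r z' x = true) -> z = z').
  { intros P [x Px].
    destruct (Hr (fun x => boolp.asbool (P x))) as [z [[Hz1 Hz2] Hz3]].
    - exists x. apply boolp.asboolT. exact Px.
    - exists z. split; [ | split].
      + exact (boolp.asboolW Hz1).
      + intros y Py. apply Hz2. apply boolp.asboolT. exact Py.
      + intros z' Pz' Hz'. apply Hz3. split.
        * apply boolp.asboolT. exact Pz'.
        * intros y Hy. apply Hz'. exact (boolp.asboolW Hy). }
  exists (fun x y => r x y = true /\ x <> y). split.
  - intros x. apply NNPP. intros Hx.
    destruct (Hmin (fun z => ~ Acc (fun x y => r x y = true /\ x <> y) z)) as [z [Hz [Hz' _]]].
    { exists x. exact Hx. }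
    apply Hz. constructor. intros y [Hyz Hne]. apply NNPP. intros Hy. apply Hne.
    assert (Hrefl : forall t, r t t = true).
    { intros t. destruct (Hmin (fun s => s = t)) as [s [Hs [Hs' _]]]; [exists t; reflexivity|].
      subst s. apply Hs'. reflexivity. }
    (* Both [y] and [z] are minima of this pair: [r y z] is given, and [r z y] holds because [z] is
       minimal among the inaccessible points. Uniqueness of the minimum identifies them. *)
    destruct (Hmin (fun s => s = y \/ s = z)) as [s [_ [_ Hs]]]; [exists y; now left|].
    transitivity s.
    + symmetry. apply Hs; [now left|]. intros t [-> | ->]; auto.
    + apply Hs; [now right|]. intros t [-> | ->]; auto.
  - intros x y. destruct (classic (x = y)) as [E | E]; [now right; left|].
    destruct (Hmin (fun s => s = x \/ s = y)) as [s [[-> | ->] [Hs _]]]; [exists x; now left| |].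
    + left. split; [apply Hs; now right | exact E].
    + right. right. split; [apply Hs; now left | congruence].
Qed.

(* If [T] injects into a segment of a well-order, pull the order back along an
   injection into the shortest such segment. *)
Lemma exists_initial_well_order (T : Type) : exists lt : T -> T -> Prop,
  well_founded lt /\ (forall x y, lt x y \/ x = y \/ lt y x) /\
  forall x, ~ exists h : T -> T, inj h /\ forall t, lt (h t) x.
Proof.
  destruct (exists_well_order T) as [lt [Hwf Htri]].
  destruct (classic (exists x, exists h : T -> T, inj h /\ forall t, lt (h t) x)) as [[x Hx] | Hno].
  - revert Hx. induction x as [x IH] using (well_founded_ind Hwf). intros [h [Hh Hlt]].
    destruct (classic (exists y, lt y x /\ exists h : T -> T, inj h /\ forall t, lt (h t) y))
      as [[y [Hy Hex]] | Hno]; [exact (IH y Hy Hex)|].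
    exists (fun a b => lt (h a) (h b)). split; [|split].
    + exact (wf_inverse_image _ _ lt h Hwf).
    + intros a b. destruct (Htri (h a) (h b)) as [? | [E | ?]]; auto.
    + intros y [h' [Hh' Hlt']]. apply Hno. exists (h y). split; [apply Hlt|].
      exists (fun t => h (h' t)). split; [|exact Hlt'].
      intros a b E. apply Hh', Hh, E.
  - exists lt. split; [exact Hwf | split; [exact Htri|]].
    intros x Hx. apply Hno. now exists x.
Qed.

(** Well-founded recursion with a choice at each stage. By the first hypothesis [P a g] depends on
    [g] only below [a], so the values built so far may be extended by the arbitrary value [x0]. *)
Lemma wf_choice_recursion (T X : Type) (x0 : X) (lt : T -> T -> Prop) (Hwf : well_founded lt)
    (P : T -> (T -> X) -> X -> Prop) :
  (forall a g g' x, (forall b, lt b a -> g b = g' b) -> P a g x -> P a g' x) ->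
  (forall a g, exists x, P a g x) ->
  exists g, forall a, P a g (g a).
Proof.
  intros Hext Hex.
  pose (ext := fun a (g : forall b, lt b a -> X) b =>
    match excluded_middle_informative (lt b a) with
    | left H => g b H | right _ => x0 end).
  pose (F := fun a (g : forall b, lt b a -> X) => epsilon (inhabits x0) (P a (ext a g))).
  exists (Fix Hwf (fun _ => X) F). intros a.
  rewrite Fix_eq.
  - apply Hext with (ext a (fun b _ => Fix Hwf (fun _ => X) F b)).
    + intros b Hb. unfold ext. destruct (excluded_middle_informative (lt b a)); [reflexivity|contradiction].
    + unfold F at 2. apply epsilon_spec, Hex.
  - intros b g g' E. f_equal. extensionality c. extensionality H. apply E.
Qed.

(** * Sets of the size of the continuum *)

(** Digits 0 and 1 in base three: a one at place [m] outweighs all later places, which add up to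
    half of it, so no two digit sequences share a value. *)
Fixpoint ternary_sum (b : K) (m : nat) : R :=
  match m with
  | O => 0
  | S m => ternary_sum b m + (if b m then (/ 3) ^ m else 0)
  end.

Lemma pow_third_pos m : 0 < (/ 3) ^ m.
Proof. apply pow_lt. lra. Qed.

Lemma ternary_sum_mono b m k : ternary_sum b m <= ternary_sum b (m + k).
Proof.
  induction k as [|k IH]; [rewrite Nat.add_0_r; lra|].
  rewrite Nat.add_succ_r. simpl. pose proof (pow_third_pos (m + k)). destruct (b (m + k)%nat); lra.
Qed.

(** [3 / 2 * (/ 3) ^ m] is the whole geometric series from place [m] on, so these upper bounds never
    increase and enclose the limit. *)
Lemma ternary_sum_tail b m k :
  ternary_sum b (m + k) + 3 / 2 * (/ 3) ^ (m + k) <= ternary_sum b m + 3 / 2 * (/ 3) ^ m.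
Proof.
  induction k as [|k IH]; [rewrite Nat.add_0_r; lra|].
  rewrite Nat.add_succ_r. simpl. pose proof (pow_third_pos (m + k)). destruct (b (m + k)%nat); lra.
Qed.

Lemma exists_ternary_value (b : K) : exists v, forall m,
  ternary_sum b m <= v <= ternary_sum b m + 3 / 2 * (/ 3) ^ m.
Proof.
  assert (Hle : forall m k, ternary_sum b k <= ternary_sum b m + 3 / 2 * (/ 3) ^ m).
  { intros m k. pose proof (pow_third_pos m) as Hm. destruct (Nat.le_ge_cases m k) as [H | H].
    - replace k with (m + (k - m))%nat by lia.
      pose proof (ternary_sum_tail b m (k - m)). pose proof (pow_third_pos (m + (k - m))). lra.
    - pose proof (ternary_sum_mono b k (m - k)) as Hk.
      replace (k + (m - k))%nat with m in Hk by lia. lra. }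
  destruct (completeness (fun x => exists k, x = ternary_sum b k)) as [v [Hv1 Hv2]].
  - exists (ternary_sum b 0 + 3 / 2 * (/ 3) ^ 0). intros x [k ->]. apply Hle.
  - exists 0. now exists 0%nat.
  - exists v. intros m. split.
    + apply Hv1. now exists m.
    + apply Hv2. intros x [k ->]. apply Hle.
Qed.

Lemma K_inj_interval : exists c : K -> R, inj c /\ forall b, 0 <= c b <= 3 / 2.
Proof.
  pose (c := fun b => proj1_sig (constructive_indefinite_description _ (exists_ternary_value b))).
  assert (Hc : forall b m, ternary_sum b m <= c b <= ternary_sum b m + 3 / 2 * (/ 3) ^ m).
  { intros b. unfold c. now destruct (constructive_indefinite_description _ _). }
  exists c. split.
  - assert (Hlt : forall b b' m, (forall k, (k < m)%nat -> b k = b' k) ->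
        b m = true -> b' m = false -> c b' < c b).
    { intros b b' m Heq Hb Hb'.
      assert (Hs : forall k, (k <= m)%nat -> ternary_sum b k = ternary_sum b' k).
      { induction k as [|k IH]; intros Hk; [reflexivity|].
        simpl. rewrite IH by lia. now rewrite Heq by lia. }
      (* With [s] the common sum of the first [m] places, [c b] is at least [s + (/ 3) ^ m], while
         [c b'] is at most [s] plus half of that power. *)
      pose proof (proj1 (Hc b (S m))) as H1. pose proof (proj2 (Hc b' (S m))) as H2.
      simpl in H1, H2. rewrite Hb in H1. rewrite Hb' in H2.
      pose proof (pow_third_pos m). rewrite (Hs m) in H1 by lia. lra. }
    intros b b' E. extensionality m.
    induction m as [m IH] using (well_founded_ind lt_wf).
    destruct (b m) eqn:Hb, (b' m) eqn:Hb'; try reflexivity; exfalso.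
    + pose proof (Hlt b b' m IH Hb Hb'). lra.
    + pose proof (Hlt b' b m (fun k Hk => eq_sym (IH k Hk)) Hb' Hb). lra.
  - intros b. pose proof (Hc b 0%nat) as H. simpl in H. lra.
Qed.

(** Cantor's diagonal: at place [m] the sequence [d] flips the bit of the sequence coded by [m],
    hence differs from itself at its own code. *)
Lemma K_not_countable (h : K -> nat) : ~ inj h.
Proof.
  intros Hh.
  pose (d := fun m => if excluded_middle_informative (exists b, h b = m /\ b m = true)
                      then false else true).
  assert (Hd : d (h d) = true <-> ~ d (h d) = true).
  { unfold d at 1. destruct (excluded_middle_informative _) as [[b [E Hb]] | Hn].
    - apply Hh in E. subst b. split; [discriminate | intros H; contradiction].
    - split; [|reflexivity]. intros _ H. apply Hn. now exists d. }
  tauto.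
Qed.

(** Only the upper bound on the cardinality is expressed: the transfinite construction may list a
    task many times. *)
Definition cont_many (X : Type) : Prop := exists s : K -> X, surj s.

(** With [K_join], this identifies Cantor space with its own countable power through Cantor
    pairing. *)
Definition K_slice (b : K) (m : nat) : K := fun j => b (to_nat (m, j)).

Definition K_join (u : nat -> K) : K := fun k => u (fst (of_nat k)) (snd (of_nat k)).

Lemma K_slice_join u m : K_slice (K_join u) m = u m.
Proof. extensionality j. unfold K_slice, K_join. now rewrite cancel_of_to. Qed.

Lemma cont_many_seq X : cont_many X -> cont_many (nat -> X).
Proof.
  intros [s Hs]. exists (fun b m => s (K_slice b m)). intros u.
  pose (t := fun x => proj1_sig (constructive_indefinite_description _ (Hs x))).
  assert (Ht : forall x, s (t x) = x).
  { intros x. unfold t. now destruct (constructive_indefinite_description _ _). }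
  exists (K_join (fun m => t (u m))). extensionality m. now rewrite K_slice_join.
Qed.

Lemma cont_many_prod X Y : cont_many X -> cont_many Y -> cont_many (X * Y).
Proof.
  intros [s Hs] [t Ht]. exists (fun b => (s (K_slice b 0), t (K_slice b 1))). intros [x y].
  destruct (Hs x) as [bx <-], (Ht y) as [b_y <-].
  exists (K_join (fun m => match m with O => bx | _ => b_y end)). now rewrite !K_slice_join.
Qed.

Lemma cont_many_inj {X Y} (x0 : X) (g : X -> Y) : inj g -> cont_many Y -> cont_many X.
Proof.
  intros Hg [s Hs]. exists (fun b => epsilon (inhabits x0) (fun x => g x = s b)). intros x.
  destruct (Hs (g x)) as [b Hb]. exists b. apply Hg. rewrite <- Hb.
  apply (epsilon_spec (inhabits x0) (fun x => g x = s b)). now exists x.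
Qed.

Lemma cont_many_surj {X Y} (g : X -> Y) : surj g -> cont_many X -> cont_many Y.
Proof.
  intros Hg [s Hs]. exists (fun b => g (s b)). intros y.
  destruct (Hg y) as [x <-], (Hs x) as [b <-]. now exists b.
Qed.

(** * Countable dense sets and the families they determine *)

Definition rat (k : nat) : R :=
  let (p, m) := of_nat k in let (i, j) := of_nat p in (INR i - INR j) / INR (S m).

Lemma rat_dense x y : x < y -> exists k, x < rat k < y.
Proof.
  intros Hxy.
  destruct (INR_unbounded (/ (y - x))) as [m Hm].
  assert (Hpos : 0 < INR (S m)) by apply lt_0_INR, Nat.lt_0_succ.
  assert (Hw : 1 < (y - x) * INR (S m)).
  { rewrite S_INR. assert (0 < y - x) by lra.
    apply Rmult_lt_compat_l with (r := y - x) in Hm; [|lra].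
    rewrite Rinv_r in Hm by lra. lra. }
  destruct (archimed (x * INR (S m))) as [H1 H2].
  set (z := up (x * INR (S m))) in *.
  (* [z] is the difference of its positive and negative parts; [Z.to_nat] truncates one of them to
     zero. *)
  exists (to_nat (to_nat (Z.to_nat z, Z.to_nat (- z)), m)).
  unfold rat. rewrite !cancel_of_to.
  replace (INR (Z.to_nat z) - INR (Z.to_nat (- z))) with (IZR z).
  2:{ rewrite !INR_IZR_INZ, <- minus_IZR. f_equal. lia. }
  split.
  - apply Rmult_lt_reg_r with (INR (S m)); [exact Hpos|].
    unfold Rdiv. rewrite Rmult_assoc, Rinv_l by lra. lra.
  - apply Rmult_lt_reg_r with (INR (S m)); [exact Hpos|].
    unfold Rdiv. rewrite Rmult_assoc, Rinv_l by lra. lra.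
Qed.

(** A real is determined by its Dedekind cut, a sequence of bits indexed by [rat]. *)
Lemma cont_many_R : cont_many R.
Proof.
  apply (cont_many_inj 0 (fun x k => if Rlt_dec (rat k) x then true else false)).
  - assert (Hlt : forall x y, x < y -> 
      (fun k => if Rlt_dec (rat k) x then true else false) <>
      (fun k => if Rlt_dec (rat k) y then true else false)).
    { intros x y Hxy E. destruct (rat_dense x y Hxy) as [k Hk].
      apply (f_equal (fun b => b k)) in E.
      destruct (Rlt_dec (rat k) x), (Rlt_dec (rat k) y); try discriminate; lra. }
    intros x y E. destruct (Rtotal_order x y) as [H | [H | H]]; [|exact H|].
    + now destruct (Hlt x y H).
    + now destruct (Hlt y x H).
  - exists (fun b => b). intros b. now exists b.
Qed.

Definition vcons {n} (x : R) (v : Rn n) : Rn (S n) :=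
  fun i => Fin.caseS' i (fun _ => R) x v.

Lemma cont_many_Rn n : cont_many (Rn n).
Proof.
  induction n as [|n IH].
  - exists (fun _ _ => 0). intros x. exists (fun _ => true). extensionality i. now apply Fin.case0.
  - apply (cont_many_surj (fun p => vcons (fst p) (snd p))).
    + intros x. exists (x Fin.F1, fun i => x (Fin.FS i)). extensionality i.
      now apply (Fin.caseS' i).
    + apply cont_many_prod; [exact cont_many_R | exact IH].
Qed.

Fixpoint dense_seq (n : nat) (k : nat) : Rn n :=
  match n with
  | O => fun _ => 0
  | S m => vcons (rat (fst (of_nat k))) (dense_seq m (snd (of_nat k)))
  end.

Lemma dense_seq_dense n (x : Rn n) d : 0 < d ->
  exists k, forall i, Rabs (dense_seq n k i - x i) < d.
Proof.
  intros Hd. induction n as [|n IH].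
  - exists 0%nat. intros i. now apply Fin.case0.
  - destruct (IH (fun i => x (Fin.FS i))) as [k Hk].
    destruct (rat_dense (x Fin.F1 - d) (x Fin.F1 + d)) as [j Hj]; [lra|].
    exists (to_nat (j, k)). cbn [dense_seq]. rewrite cancel_of_to. intros i.
    apply (Fin.caseS' i); simpl; [|exact Hk]. apply Rabs_def1; lra.
Qed.

(** A continuous function is determined by its values on a countable dense set, which form a
    sequence of reals. *)
Lemma cont_many_continuous n : cont_many {f : Rn n -> R | continuous_Rn f}.
Proof.
  assert (H0 : continuous_Rn (fun _ : Rn n => 0)).
  { intros x eps Heps. exists 1. split; [lra|]. intros y _. now rewrite Rminus_diag, Rabs_R0. }
  apply (cont_many_inj (exist _ _ H0) (fun f k => proj1_sig f (dense_seq n k))).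
  2: exact (cont_many_seq _ cont_many_R).
  intros [f Hf] [g Hg] E. simpl in E.
  assert (Efg : f = g).
  { extensionality x. apply NNPP. intros Hne.
    assert (He : 0 < Rabs (f x - g x) / 2).
    { pose proof (Rabs_pos_lt (f x - g x)). lra. }
    destruct (Hf x _ He) as [d1 [Hd1 H1]], (Hg x _ He) as [d2 [Hd2 H2]].
    destruct (dense_seq_dense n x (Rmin d1 d2)) as [k Hk]; [now apply Rmin_pos|].
    pose proof (Rmin_l d1 d2). pose proof (Rmin_r d1 d2).
    specialize (H1 (dense_seq n k)). specialize (H2 (dense_seq n k)).
    apply (f_equal (fun u => u k)) in E. rewrite E in H1.
    assert (Hx1 := H1 (fun i => Rlt_le_trans _ _ _ (Hk i) H)).
    assert (Hx2 := H2 (fun i => Rlt_le_trans _ _ _ (Hk i) H3)).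
    pose proof (Rabs_triang (g (dense_seq n k) - g x) (- (g (dense_seq n k) - f x))) as Ht.
    rewrite Rabs_Ropp in Ht.
    replace (g (dense_seq n k) - g x + - (g (dense_seq n k) - f x)) with (f x - g x) in Ht by ring.
    lra. }
  subst g. f_equal. apply proof_irrelevance.
Qed.

(** * Sums over lists *)

Definition sumR {A : Type} (w : A -> R) (l : list A) : R := fold_right Rplus 0 (map w l).

Lemma sumR_cons {A} (w : A -> R) a l : sumR w (a :: l) = w a + sumR w l.
Proof. reflexivity. Qed.

Lemma sumR_app {A} (w : A -> R) l l' : sumR w (l ++ l') = sumR w l + sumR w l'.
Proof.
  induction l as [|a l IH]; [unfold sumR; simpl; ring|].
  simpl app. rewrite !sumR_cons, IH. ring.
Qed.

Lemma sumR_map {A B} (w : B -> R) (g : A -> B) l : sumR w (map g l) = sumR (fun a => w (g a)) l.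
Proof. unfold sumR. now rewrite map_map. Qed.

Lemma sumR_flat_map {A B} (w : B -> R) (g : A -> list B) l :
  sumR w (flat_map g l) = sumR (fun a => sumR w (g a)) l.
Proof.
  induction l as [|a l IH]; [reflexivity|].
  simpl flat_map. now rewrite sumR_app, sumR_cons, IH.
Qed.

Lemma sumR_le {A} (w w' : A -> R) l :
  (forall a, In a l -> w a <= w' a) -> sumR w l <= sumR w' l.
Proof.
  induction l as [|a l IH]; intros H; [apply Rle_refl|].
  rewrite !sumR_cons. apply Rplus_le_compat; [apply H; now left|].
  apply IH. intros b Hb. apply H. now right.
Qed.

Lemma sumR_ext {A} (w w' : A -> R) l : (forall a, In a l -> w a = w' a) -> sumR w l = sumR w' l.
Proof. intros H. apply Rle_antisym; apply sumR_le; intros a Ha; rewrite H by exact Ha; apply Rle_refl. Qed.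

Lemma sumR_scal {A} (w : A -> R) c l : sumR (fun a => c * w a) l = c * sumR w l.
Proof.
  induction l as [|a l IH]; [unfold sumR; simpl; ring|]. rewrite !sumR_cons, IH. ring.
Qed.

Lemma sumR_const {A} c (l : list A) : sumR (fun _ => c) l = INR (length l) * c.
Proof.
  induction l as [|a l IH]; [unfold sumR; simpl; ring|].
  rewrite sumR_cons, IH. simpl length. rewrite S_INR. ring.
Qed.

Lemma sumR_plus {A} (w w' : A -> R) l : sumR (fun a => w a + w' a) l = sumR w l + sumR w' l.
Proof.
  induction l as [|a l IH]; [unfold sumR; simpl; ring|]. rewrite !sumR_cons, IH. ring.
Qed.

Lemma sumR_exchange {A B} (w : A -> B -> R) l l' :
  sumR (fun a => sumR (w a) l') l = sumR (fun b => sumR (fun a => w a b) l) l'.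
Proof.
  induction l as [|a l IH].
  - change (sumR (fun a => sumR (w a) l') nil) with 0.
    rewrite (sumR_ext _ (fun _ => 0)) by reflexivity. rewrite sumR_const. ring.
  - rewrite sumR_cons, IH, <- sumR_plus. now apply sumR_ext.
Qed.

Lemma sumR_nonneg {A} (w : A -> R) l : (forall a, In a l -> 0 <= w a) -> 0 <= sumR w l.
Proof.
  intros H. replace 0 with (sumR (fun _ => 0) l) by (rewrite sumR_const; ring).
  now apply sumR_le.
Qed.

(** Each nonzero term of [l] is cancelled against one occurrence in [l']; as [l] has no repetitions,
    that occurrence is not wanted again. *)
Lemma sumR_incl {A} (w : A -> R) l l' :
  (forall a, 0 <= w a) -> NoDup l -> (forall a, In a l -> w a <> 0 -> In a l') ->
  sumR w l <= sumR w l'.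
Proof.
  intros Hw Hnd. revert l'. induction Hnd as [|a l Ha Hnd IH]; intros l' Hin.
  - now apply sumR_nonneg.
  - rewrite sumR_cons. destruct (Req_dec (w a) 0) as [E | E].
    + rewrite E, Rplus_0_l. apply IH. intros b Hb. apply Hin. now right.
    + destruct (in_split a l') as [l1 [l2 ->]]; [apply Hin; [now left | exact E]|].
      rewrite sumR_app, sumR_cons.
      enough (sumR w l <= sumR w (l1 ++ l2)) as H by (rewrite sumR_app in H; lra).
      apply IH. intros b Hb Hwb.
      assert (Hb' : In b (l1 ++ a :: l2)) by (apply Hin; [now right | exact Hwb]).
      apply in_app_or in Hb'. apply in_or_app.
      destruct Hb' as [? | [-> | ?]]; [now left | contradiction | now right].
Qed.

Lemma sum_f_R0_sumR (w : nat -> R) m : sum_f_R0 w m = sumR w (seq 0 (S m)).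
Proof.
  induction m as [|m IH]; [unfold sumR; simpl; ring|].
  rewrite seq_S, sumR_app, <- IH. unfold sumR. simpl. ring.
Qed.

Lemma map_nth_seq {A} (l : list A) d : map (fun j => nth j l d) (seq 0 (length l)) = l.
Proof.
  induction l as [|a l IH]; [reflexivity|].
  simpl. f_equal. rewrite <- seq_shift, map_map. exact IH.
Qed.

(** * Covers by boxes *)

Lemma fprod_nonneg n (g : Fin.t n -> R) : (forall i, 0 <= g i) -> 0 <= fprod n g.
Proof.
  induction n as [|n IH]; intros H; simpl; [lra|].
  apply Rmult_le_pos; [apply H|]. apply IH. intros i. apply H.
Qed.

Definition vol {n} (c : Rn n * Rn n) : R := box_vol (fst c) (snd c).

Definition proper_box {n} (c : Rn n * Rn n) : Prop := forall i, fst c i <= snd c i.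

Lemma vol_nonneg {n} (c : Rn n * Rn n) : proper_box c -> 0 <= vol c.
Proof. intros H. apply fprod_nonneg. intros i. specialize (H i). lra. Qed.

(** A bound on outer Jordan content. Finite covers suffice because they are applied to the part of a
    level set inside a cube. *)
Definition fin_cover {n} (S : Rn n -> Prop) (eps : R) : Prop :=
  exists l : list (Rn n * Rn n),
    (forall c, In c l -> proper_box c) /\
    (forall x, S x -> exists c, In c l /\ in_box (fst c) (snd c) x) /\
    sumR vol l <= eps.

Definition centered {n} (M : nat) (x : Rn n) : Prop := forall i, - INR M <= x i <= INR M.

Lemma exists_centered n (x : Rn n) : exists M, centered M x.
Proof.
  induction n as [|n IH].
  - exists 0%nat. intros i. now apply Fin.case0.
  - destruct (IH (fun i => x (Fin.FS i))) as [M HM].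
    destruct (INR_unbounded (Rabs (x Fin.F1))) as [m Hm].
    exists (M + m)%nat.
    pose proof (pos_INR M). pose proof (pos_INR m). intros i. rewrite plus_INR.
    apply (Fin.caseS' i).
    + pose proof (Rle_abs (x Fin.F1)). pose proof (Rle_abs (- x Fin.F1)) as H2.
      rewrite Rabs_Ropp in H2. lra.
    + intros j. specialize (HM j). simpl in HM. lra.
Qed.

Lemma sum_half_pow_le m : sumR (fun i => (/ 2) ^ (S i)) (seq 0 m) <= 1.
Proof.
  enough (H : sumR (fun i => (/ 2) ^ (S i)) (seq 0 m) = 1 - (/ 2) ^ m).
  { rewrite H. pose proof (pow_lt (/ 2) m). lra. }
  induction m as [|m IH]; [unfold sumR; simpl; ring|].
  rewrite seq_S, sumR_app, IH. unfold sumR. simpl. field.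
Qed.

(** The part in the cube of half-width [M] is covered with volume at most [eps / 2 ^ (M + 1)], and
    the finite lists are merged into one sequence by Cantor pairing. *)
Lemma null_of_fin_cover n (S : Rn n -> Prop) : (0 < n)%nat ->
  (forall M eps, 0 < eps -> fin_cover (fun x => S x /\ centered M x) eps) -> lebesgue_null S.
Proof.
  intros Hn HS eps Heps.
  destruct (choice (fun M (l : list (Rn n * Rn n)) =>
    (forall c, In c l -> proper_box c) /\
    (forall x, S x /\ centered M x -> exists c, In c l /\ in_box (fst c) (snd c) x) /\
    sumR vol l <= eps * (/ 2) ^ (Datatypes.S M))) as [L HL].
  { intros M. apply HS. apply Rmult_lt_0_compat; [exact Heps | apply pow_lt; lra]. }
  (* The degenerate box [z] pads each list past its end. Its volume is zero because [n] is positive;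
     the empty product would be 1. *)
  pose (o := (fun _ => 0) : Rn n). pose (z := (o, o)).
  assert (Hz : vol z = 0).
  { destruct n as [|n']; [lia|]. unfold vol, box_vol. simpl. ring. }
  pose (box := fun p : nat * nat => nth (snd p) (L (fst p)) z).
  assert (Hbox : forall p, proper_box (box p)).
  { intros [i j]. unfold box. destruct (nth_in_or_default j (L i) z) as [H | H]; simpl.
    - exact (proj1 (HL i) _ H).
    - rewrite H. intros k. apply Rle_refl. }
  exists (fun k => fst (box (of_nat k))), (fun k => snd (box (of_nat k))). split; [|split].
  - intros k. apply Hbox.
  - intros x Sx. destruct (exists_centered n x) as [M HM].
    destruct (proj1 (proj2 (HL M)) x (conj Sx HM)) as [c [Hc Hx]].
    destruct (In_nth _ _ z Hc) as [j [_ Hj]].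
    exists (to_nat (M, j)). rewrite cancel_of_to.
    unfold box. cbn [fst snd]. now rewrite Hj.
  - intros m. rewrite sum_f_R0_sumR.
    change (fun k => box_vol (fst (box (of_nat k))) (snd (box (of_nat k))))
      with (fun k => vol (box (of_nat k))).
    rewrite <- (sumR_map (fun p => vol (box p)) of_nat).
    (* Codes up to [m] have first component at most [m], so apart from padding of volume zero only
       boxes of the lists [L 0] to [L m] occur. *)
    apply Rle_trans with (sumR (fun p => vol (box p))
      (flat_map (fun i => map (pair i) (seq 0 (length (L i)))) (seq 0 (Datatypes.S m)))).
    + apply sumR_incl.
      * intros p. apply vol_nonneg, Hbox.
      * apply Injective_map_NoDup; [exact of_nat_inj | apply seq_NoDup].
      * intros [i j] Hij Hv. apply in_map_iff in Hij. destruct Hij as [k [Hk Hkm]].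
        apply in_seq in Hkm. apply (f_equal to_nat) in Hk. rewrite cancel_to_of in Hk.
        pose proof (to_nat_non_decreasing i j).
        apply in_flat_map. exists i. split; [apply in_seq; lia|].
        apply in_map, in_seq. split; [lia|]. apply NNPP. intros Hlt. apply Hv.
        change (vol (nth j (L i) z) = 0). rewrite nth_overflow by lia. exact Hz.
    + rewrite sumR_flat_map.
      apply Rle_trans with (sumR (fun i => eps * (/ 2) ^ (Datatypes.S i)) (seq 0 (Datatypes.S m))).
      * apply sumR_le. intros i _. rewrite sumR_map.
        rewrite <- (sumR_map vol (fun j => nth j (L i) z)), map_nth_seq. apply HL.
      * rewrite sumR_scal. pose proof (sum_half_pow_le (Datatypes.S m)). nra.
Qed.

(** The subdivision of the cube with lower corner [a] and side [k * w] into [k ^ n] cells of side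
    [w]. *)
Fixpoint grid (a w : R) (k n : nat) : list (Rn n * Rn n) :=
  match n with
  | O => (fun _ => 0, fun _ => 0) :: nil
  | S m => flat_map (fun j => map
      (fun c => (vcons (a + INR j * w) (fst c), vcons (a + INR (S j) * w) (snd c)))
      (grid a w k m)) (seq 0 k)
  end.

Lemma grid_vol a w k n : sumR vol (grid a w k n) = (INR k * w) ^ n.
Proof.
  induction n as [|n IH]; [unfold sumR, vol, box_vol; simpl; ring|].
  cbn [grid]. rewrite sumR_flat_map.
  rewrite (sumR_ext _ (fun _ => w * (INR k * w) ^ n)).
  - rewrite sumR_const, length_seq. simpl. ring.
  - intros j _. rewrite sumR_map, <- IH, <- sumR_scal. apply sumR_ext. intros c _.
    unfold vol, box_vol. cbn [fprod vcons fst snd Fin.caseS']. rewrite S_INR. simpl. ring.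
Qed.

Lemma grid_width a w k n c : In c (grid a w k n) -> forall i, snd c i = fst c i + w.
Proof.
  revert c. induction n as [|n IH]; intros c Hc i; [now apply Fin.case0|].
  cbn [grid] in Hc. apply in_flat_map in Hc. destruct Hc as [j [_ Hc]].
  apply in_map_iff in Hc. destruct Hc as [c' [<- Hc']].
  apply (Fin.caseS' i); cbn [vcons fst snd Fin.caseS'].
  - rewrite S_INR. simpl. ring.
  - intros i'. exact (IH c' Hc' i').
Qed.

Lemma exists_grid_interval a w k t : 0 < w -> (0 < k)%nat -> a <= t <= a + INR k * w ->
  exists j, (j < k)%nat /\ a + INR j * w <= t <= a + INR (S j) * w.
Proof.
  intros Hw Hk. induction k as [|k IH]; [lia|]. intros Ht.
  destruct (Rle_dec (a + INR k * w) t) as [H | H]; [exists k; split; [lia | lra]|].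
  destruct k as [|k]; [simpl in *; lra|].
  destruct IH as [j [Hj Hj']]; [lia | lra|]. exists j. split; [lia | exact Hj'].
Qed.

Lemma grid_cover a w k n (x : Rn n) : 0 < w -> (0 < k)%nat ->
  (forall i, a <= x i <= a + INR k * w) ->
  exists c, In c (grid a w k n) /\ in_box (fst c) (snd c) x.
Proof.
  intros Hw Hk. induction n as [|n IH]; intros Hx.
  - eexists. split; [now left|]. intros i. now apply Fin.case0.
  - destruct (IH (fun i => x (Fin.FS i))) as [c [Hc Hcx]]; [intros i; apply Hx|].
    destruct (exists_grid_interval a w k (x Fin.F1) Hw Hk (Hx Fin.F1)) as [j [Hj Hjx]].
    exists (vcons (a + INR j * w) (fst c), vcons (a + INR (S j) * w) (snd c)). split.
    + cbn [grid]. apply in_flat_map. exists j. split; [apply in_seq; lia|].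
      apply in_map_iff. now exists c.
    + intros i. apply (Fin.caseS' i); [exact Hjx | exact Hcx].
Qed.

(** * Level sets of continuous functions *)

(** Coquelicot states compactness of boxes for iterated pairs; [to_Tn] and [of_Tn] transfer it to
    functions on [Fin.t n]. *)
Fixpoint to_Tn (n : nat) : Rn n -> Compactness.Tn n R :=
  match n with
  | O => fun _ => tt
  | S m => fun x => (x Fin.F1, to_Tn m (fun i => x (Fin.FS i)))
  end.

Fixpoint of_Tn (n : nat) : Compactness.Tn n R -> Rn n :=
  match n with
  | O => fun _ _ => 0
  | S m => fun t => vcons (fst t) (of_Tn m (snd t))
  end.

Lemma bounded_to_Tn n (a b x : Rn n) :
  in_box a b x -> Compactness.bounded_n n (to_Tn n a) (to_Tn n b) (to_Tn n x).
Proof.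
  induction n as [|n IH]; intros H; simpl; [exact I|].
  split; [apply H|]. apply IH. intros i. apply H.
Qed.

Lemma close_to_Tn n d (x : Rn n) t :
  Compactness.close_n n d (to_Tn n x) t -> forall i, Rabs (x i - of_Tn n t i) < d.
Proof.
  induction n as [|n IH]; intros H i; [now apply Fin.case0|].
  destruct t as [t1 t2]. simpl in H. destruct H as [H1 H2].
  apply (Fin.caseS' i); [exact H1|]. exact (IH _ _ H2).
Qed.

Lemma uniform_continuity n (f : Rn n -> R) (a b : Rn n) eps :
  continuous_Rn f -> 0 < eps ->
  exists d, 0 < d /\ forall x y, in_box a b x -> (forall i, Rabs (y i - x i) < d) ->
    Rabs (f y - f x) < eps.
Proof.
  intros Hf Heps.
  (* [D] is half a radius of continuity: if [x] is within [D c] of a centre [c] and [y] within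
     [d <= D c] of [x], then both lie within [2 * D c] of [c]. *)
  destruct (choice (fun (x : Rn n) (d : posreal) =>
    forall y, (forall i, Rabs (y i - x i) < 2 * d) -> Rabs (f y - f x) < eps / 2)) as [D HD].
  { intros x. destruct (Hf x (eps / 2)) as [d [Hd H]]; [lra|].
    assert (Hd2 : 0 < d / 2) by lra.
    exists (mkposreal _ Hd2). simpl. intros y Hy. apply H. intros i. specialize (Hy i). lra. }
  destruct (Compactness.compactness_value n (to_Tn n a) (to_Tn n b) (fun t => D (of_Tn n t)))
    as [d Hd].
  exists d. split; [apply cond_pos|]. intros x y Hx Hxy.
  apply NNPP. intros Hno. apply (Hd (to_Tn n x) (bounded_to_Tn n a b x Hx)).
  intros [t [_ [Hxt Hdt]]]. apply Hno. pose proof (close_to_Tn _ _ _ _ Hxt) as Hxt'.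
  set (c := of_Tn n t) in *. pose proof (cond_pos (D c)).
  assert (H1 : Rabs (f x - f c) < eps / 2).
  { apply HD. intros i. specialize (Hxt' i). lra. }
  assert (H2 : Rabs (f y - f c) < eps / 2).
  { apply HD. intros i. specialize (Hxt' i). specialize (Hxy i).
    pose proof (Rabs_triang (y i - x i) (x i - c i)) as Ht.
    replace (y i - x i + (x i - c i)) with (y i - c i) in Ht by ring. lra. }
  pose proof (Rabs_triang (f y - f c) (- (f x - f c))) as Ht. rewrite Rabs_Ropp in Ht.
  replace (f y - f c + - (f x - f c)) with (f y - f x) in Ht by ring. lra.
Qed.

Lemma list_separation (l : list R) :
  exists e, 0 < e /\ forall y y', In y l -> In y' l -> Rabs (y - y') < e -> y = y'.
Proof.
  induction l as [|a l [e [He IH]]]; [exists 1; split; [lra | intros y y' []]|].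
  assert (Ha : exists e', 0 < e' /\ forall y, In y l -> Rabs (y - a) < e' -> y = a).
  { clear. induction l as [|b l [e [He IH]]]; [exists 1; split; [lra | intros y []]|].
    destruct (Req_dec b a) as [-> | Hne].
    - exists e. split; [exact He|]. intros y [<- | Hy]; auto.
    - exists (Rmin e (Rabs (b - a))). split.
      + apply Rmin_pos; [exact He | apply Rabs_pos_lt; lra].
      + pose proof (Rmin_l e (Rabs (b - a))). pose proof (Rmin_r e (Rabs (b - a))).
        intros y [<- | Hy] Hya; [lra | apply IH; [exact Hy | lra]]. }
  destruct Ha as [e' [He' Ha]].
  exists (Rmin e e'). split; [now apply Rmin_pos|].
  pose proof (Rmin_l e e'). pose proof (Rmin_r e e').
  intros y y' [<- | Hy] [<- | Hy'] Hd.
  - reflexivity.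
  - symmetry. apply Ha; [exact Hy' | rewrite Rabs_minus_sym; lra].
  - apply Ha; [exact Hy | lra].
  - apply IH; [exact Hy | exact Hy' | lra].
Qed.

Definition indic (P : Prop) : bool := if excluded_middle_informative P then true else false.

Lemma indic_true P : indic P = true <-> P.
Proof. unfold indic. destruct (excluded_middle_informative P); split; auto; discriminate. Qed.

Lemma sumR_at_most_one {A} (p : A -> bool) v l : 0 <= v -> NoDup l ->
  (forall y y', In y l -> In y' l -> p y = true -> p y' = true -> y = y') ->
  sumR (fun y => if p y then v else 0) l <= v.
Proof.
  intros Hv Hnd. induction Hnd as [|a l Ha Hnd IH]; intros H; [exact Hv|].
  rewrite sumR_cons. destruct (p a) eqn:E.
  - rewrite (sumR_ext _ (fun _ => 0)); [rewrite sumR_const; lra|].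
    intros b Hb. destruct (p b) eqn:E'; [|reflexivity].
    rewrite (H a b) in Ha; [contradiction | now left | now right | exact E | exact E'].
  - rewrite Rplus_0_l. apply IH. intros y y' Hy Hy'. apply H; now right.
Qed.

Lemma sumR_filter {A} (w : A -> R) (p : A -> bool) l :
  sumR w (filter p l) = sumR (fun a => if p a then w a else 0) l.
Proof.
  induction l as [|a l IH]; [reflexivity|]. simpl filter. rewrite sumR_cons, <- IH.
  destruct (p a); [reflexivity|]. ring.
Qed.

(* On a fine enough grid of the cube, each cell meets at most one of the level
   sets, so the cells meeting the various level sets have total volume at most
   that of the cube. *)
Lemma few_large_levels n (f : Rn n -> R) M eps : continuous_Rn f -> 0 < eps ->
  exists N, forall l, NoDup l ->
    (forall y, In y l -> ~ fin_cover (fun x => f x = y /\ centered M x) eps) ->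
    (length l <= N)%nat.
Proof.
  intros Hf Heps.
  (* The volume of the gridded cube divided by the volume that each large level set must occupy. *)
  destruct (INR_unbounded ((2 * (INR M + 1)) ^ n / eps)) as [N HN].
  exists N. intros l Hnd Hl. apply INR_le.
  destruct (list_separation l) as [e [He Hsep]].
  destruct (uniform_continuity n f (fun _ => - INR M) (fun _ => INR M) e Hf He) as [d [Hd Hunif]].
  pose proof (pos_INR M) as HM.
  destruct (INR_unbounded (2 * (INR M + 1) / d)) as [k0 Hk0].
  pose (k := S k0).
  assert (Hk : 2 * (INR M + 1) / d < INR k) by (unfold k; rewrite S_INR; lra).
  assert (Hkpos : 0 < INR k) by (apply lt_0_INR; unfold k; lia).
  (* Half-width [M + 1] rather than [M] keeps the cell side positive when [M] is zero. *)
  pose (w := 2 * (INR M + 1) / INR k).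
  assert (Hkw : INR k * w = 2 * (INR M + 1)) by (unfold w; field; lra).
  assert (Hw : 0 < w) by (apply Rdiv_lt_0_compat; lra).
  assert (Hwd : w < d).
  { apply Rmult_lt_reg_l with (INR k); [exact Hkpos|]. rewrite Hkw.
    apply Rmult_lt_compat_r with (r := d) in Hk; [|exact Hd].
    replace (2 * (INR M + 1) / d * d) with (2 * (INR M + 1)) in Hk by (field; lra). exact Hk. }
  pose (G := grid (- (INR M + 1)) w k n).
  pose (meets := fun y (c : Rn n * Rn n) =>
    indic (exists x, in_box (fst c) (snd c) x /\ f x = y /\ centered M x)).
  assert (Hprop : forall c, In c G -> proper_box c).
  { intros c Hc i. rewrite (grid_width _ _ _ _ _ Hc i). lra. }
  (* Otherwise the cells meeting the level set would form a cover forbidden by [Hl]. *)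
  assert (Hlow : forall y, In y l -> eps <= sumR (fun c => if meets y c then vol c else 0) G).
  { intros y Hy. apply Rlt_le, Rnot_le_lt. intros Hle. apply (Hl y Hy).
    exists (filter (meets y) G). split; [|split].
    - intros c Hc. apply filter_In in Hc. now apply Hprop.
    - intros x [Hfx Hx].
      destruct (grid_cover (- (INR M + 1)) w k n x) as [c [Hc Hcx]]; [exact Hw | unfold k; lia | |].
      + intros i. specialize (Hx i). lra.
      + exists c. split; [|exact Hcx]. apply filter_In. split; [exact Hc|].
        apply indic_true. now exists x.
    - now rewrite sumR_filter. }
  assert (Hup : sumR (fun c => sumR (fun y => if meets y c then vol c else 0) l) G <= sumR vol G).
  { apply sumR_le. intros c Hc. apply sumR_at_most_one; [now apply vol_nonneg, Hprop | exact Hnd|].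
    intros y y' Hy Hy' Hm Hm'. apply (proj1 (indic_true _)) in Hm, Hm'.
    (* Two points of one cell differ by at most [w < d] in each coordinate, so their values are
       closer than the separation [e] of the list. *)
    destruct Hm as [x [Hcx [<- Hx]]], Hm' as [x' [Hcx' [<- Hx']]].
    apply Hsep; [exact Hy | exact Hy' |].
    apply Hunif; [exact Hx'|]. intros i. specialize (Hcx i). specialize (Hcx' i).
    rewrite (grid_width _ _ _ _ _ Hc i) in Hcx, Hcx'. apply Rabs_def1; lra. }
  unfold G in Hup at 2. rewrite grid_vol, Hkw in Hup.
  (* Double counting: summed level by level instead of cell by cell, the total is at least
     [length l * eps]. *)
  rewrite <- sumR_exchange in Hup.
  apply sumR_le in Hlow. rewrite sumR_const in Hlow.
  apply Rmult_le_reg_r with eps; [exact Heps|].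
  apply Rmult_lt_compat_r with (r := eps) in HN; [|exact Heps].
  replace ((2 * (INR M + 1)) ^ n / eps * eps) with ((2 * (INR M + 1)) ^ n) in HN by (field; lra).
  lra.
Qed.

Lemma exists_list_of_bounded {T : Type} N (P : T -> Prop) :
  (forall l, NoDup l -> (forall x, In x l -> P x) -> (length l <= N)%nat) ->
  exists l, forall x, P x -> In x l.
Proof.
  revert P. induction N as [|N IH]; intros P H;
    (destruct (classic (exists x, P x)) as [[x Px] | Hno];
      [|exists nil; intros x Px; exfalso; apply Hno; now exists x]).
  - specialize (H (x :: nil)). simpl in H. exfalso.
    enough (1 <= 0)%nat by lia. apply H.
    + constructor; [now intros [] | constructor].
    + now intros y [<- | []].
  - destruct (IH (fun y => P y /\ y <> x)) as [l Hl].
    + intros l Hnd Hl. enough (length (x :: l) <= S N)%nat by (simpl in *; lia). apply H.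
      * constructor; [|exact Hnd]. intros Hx. now apply (Hl x Hx).
      * intros y [<- | Hy]; [exact Px | now apply Hl].
    + exists (x :: l). intros y Py. destruct (classic (y = x)) as [-> | Hne]; [now left|].
      right. now apply Hl.
Qed.

(** A non-null level set violates [fin_cover] for some cube [M] and tolerance [1 / (j + 1)], and
    each pair [(M, j)] admits only finitely many such values. *)
Lemma non_null_levels_countable n (f : Rn n -> R) : (0 < n)%nat -> continuous_Rn f ->
  exists e : nat -> R, forall y, ~ lebesgue_null (fun x : Rn n => f x = y) -> exists k, e k = y.
Proof.
  intros Hn Hf.
  destruct (choice (fun (p : nat * nat) l => forall y,
    ~ fin_cover (fun x => f x = y /\ centered (fst p) x) (/ INR (S (snd p))) -> In y l)) as [L HL].
  { intros [M j]. cbn [fst snd].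
    destruct (few_large_levels n f M (/ INR (S j)) Hf) as [N HN].
    - apply Rinv_0_lt_compat, lt_0_INR. lia.
    - exact (exists_list_of_bounded N _ HN). }
  (* Past the end of a list the default 0 is enumerated; this is harmless, since [e] may also take
     values with null level sets. *)
  exists (fun k => nth (snd (of_nat k)) (L (of_nat (fst (of_nat k)))) 0).
  intros y Hy.
  assert (Hp : exists M j, ~ fin_cover (fun x => f x = y /\ centered M x) (/ INR (S j))).
  { apply NNPP. intros Hno. apply Hy. apply null_of_fin_cover; [exact Hn|].
    intros M eps Heps. destruct (INR_unbounded (/ eps)) as [j Hj].
    destruct (classic (fin_cover (fun x => f x = y /\ centered M x) (/ INR (S j)))) as [H | H].
    - destruct H as [l [H1 [H2 H3]]]. exists l. split; [exact H1 | split; [exact H2|]].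
      apply Rle_trans with (1 := H3). rewrite <- (Rinv_inv eps).
      apply Rlt_le, Rinv_lt_contravar; [|rewrite S_INR; lra].
      assert (0 < / eps) by now apply Rinv_0_lt_compat.
      apply Rmult_lt_0_compat; [assumption|]. rewrite S_INR. lra.
    - exfalso. apply Hno. now exists M, j. }
  destruct Hp as [M [j Hp]].
  destruct (In_nth _ _ 0 (HL (M, j) y Hp)) as [i [_ Hi]].
  exists (to_nat (to_nat (M, j), i)). rewrite !cancel_of_to. cbn [fst snd].
  now rewrite cancel_of_to.
Qed.

Lemma level_closed n (f : Rn n -> R) y : continuous_Rn f -> Defs.closed_set (fun x : Rn n => f x = y).
Proof.
  intros Hf x Hx. assert (He : 0 < Rabs (f x - y)) by (apply Rabs_pos_lt; lra).
  destruct (Hf x _ He) as [d [Hd H]]. exists d. split; [exact Hd|].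
  intros z Hz E. specialize (H z Hz). rewrite E, Rabs_minus_sym in H. lra.
Qed.

(** * The transfinite construction *)

(* [K] splits into [K]-many slices of size [K]: one of them misses the countable
   set, and it is too large to be covered by the image of a segment. *)
Lemma exists_value_avoiding (lt : K -> K -> Prop) (a : K) (e : nat -> R) (u : K -> R) p q :
  (~ exists h : K -> K, inj h /\ forall t, lt (h t) a) -> p < q ->
  exists y, p <= y <= q /\ (forall k, e k <> y) /\ forall b, lt b a -> u b <> y.
Proof.
  intros Hseg Hpq. destruct K_inj_interval as [c [Hc Hc01]].
  (* As [c] is at most [3 / 2], the factor [(q - p) / 2] keeps [phi] within [[p, q]]. *)
  pose (phi := fun r s : K =>
    p + (q - p) / 2 * c (K_join (fun m => match m with O => r | _ => s end))).
  assert (Hphi : forall r s r' s', phi r s = phi r' s' -> r = r' /\ s = s').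
  { intros r s r' s' E. unfold phi in E. apply Rplus_eq_reg_l in E.
    apply Rmult_eq_reg_l in E; [|lra]. apply Hc in E.
    split.
    - apply (f_equal (fun b => K_slice b 0)) in E. now rewrite !K_slice_join in E.
    - apply (f_equal (fun b => K_slice b 1)) in E. now rewrite !K_slice_join in E. }
  (* If every slice met the sequence [e], an index of a meeting point would inject [K] into
     [nat]. *)
  assert (Hr : exists r, forall s k, e k <> phi r s).
  { apply NNPP. intros Hno.
    destruct (choice (fun r k => exists s, e k = phi r s)) as [h Hh].
    - intros r. apply NNPP. intros Hr. apply Hno. exists r. intros s k E. apply Hr. now exists k, s.
    - apply (K_not_countable h). intros r r' E.
      destruct (Hh r) as [s Hs], (Hh r') as [s' Hs'].
      apply (Hphi r s r' s'). now rewrite <- Hs, <- Hs', E. }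
  destruct Hr as [r Hr].
  assert (Hs : exists s, forall b, lt b a -> u b <> phi r s).
  { apply NNPP. intros Hno.
    destruct (choice (fun s b => lt b a /\ u b = phi r s)) as [h Hh].
    - intros s. apply NNPP. intros Hs. apply Hno. exists s. intros b Hb E. apply Hs. now exists b.
    - apply Hseg. exists h. split; [|apply Hh]. intros s s' E.
      apply (Hphi r s r s'). rewrite <- (proj2 (Hh s)), <- (proj2 (Hh s')). now rewrite E. }
  destruct Hs as [s Hs]. exists (phi r s). split; [|split].
  - unfold phi. match goal with |- context [c ?b] => pose proof (Hc01 b) end. split; nra.
  - intros k. apply Hr.
  - exact Hs.
Qed.

(** Choosing an index below [a] for each member injects [F] into a segment, hence into the reals. An
    injection of the reals into [F] would then embed [K] into that segment. *)
Lemma card_lt_segment_image {T : Type} (lt : K -> K -> Prop) (a : K) (F : T -> Prop) (S : K -> T) :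
  (~ exists h : K -> K, inj h /\ forall t, lt (h t) a) ->
  (forall X, F X -> exists b, lt b a /\ X = S b) -> card_lt_continuum F.
Proof.
  intros Hseg HF. destruct K_inj_interval as [c [Hc _]].
  destruct (choice (fun (X : {X | F X}) b => lt b a /\ proj1_sig X = S b)) as [h Hh].
  { intros [X HX]. exact (HF X HX). }
  assert (Hinj : inj h).
  { intros X Y E. apply eq_sig_hprop; [intros; apply proof_irrelevance|].
    now rewrite (proj2 (Hh X)), (proj2 (Hh Y)), E. }
  split.
  - exists (fun X => c (h X)). intros X Y E. apply Hinj, Hc, E.
  - intros [g Hg]. apply Hseg. exists (fun t => h (g (c t))). split; [|intros t; apply Hh].
    intros s t E. apply Hc, Hg, Hinj, E.
Qed.

(** There may be more than continuum many null sets, but each lies in a null set of this form, and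
    these are coded by double sequences of boxes. *)
Definition cover_inter {n} (c : nat -> nat -> Rn n * Rn n) : Rn n -> Prop :=
  fun x => forall m, exists k, in_box (fst (c m k)) (snd (c m k)) x.

Lemma null_in_cover_inter n (A : Rn n -> Prop) : lebesgue_null A ->
  exists c : nat -> nat -> Rn n * Rn n,
    lebesgue_null (cover_inter c) /\ forall x, A x -> cover_inter c x.
Proof.
  intros HA.
  destruct (choice (fun m (c : nat -> Rn n * Rn n) =>
    (forall k, proper_box (c k)) /\
    (forall x, A x -> exists k, in_box (fst (c k)) (snd (c k)) x) /\
    (forall N, sum_f_R0 (fun k => vol (c k)) N <= / INR (S m)))) as [c Hc].
  { intros m. destruct (HA (/ INR (S m))) as [a [b [H1 [H2 H3]]]].
    - apply Rinv_0_lt_compat, lt_0_INR. lia.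
    - exists (fun k => (a k, b k)). split; [exact H1 | split; [exact H2 | exact H3]]. }
  exists c. split.
  - intros eps Heps. destruct (INR_unbounded (/ eps)) as [m Hm].
    destruct (Hc m) as [H1 [_ H3]].
    exists (fun k => fst (c m k)), (fun k => snd (c m k)). split; [exact H1 | split].
    + intros x Hx. apply Hx.
    + intros N. apply Rle_trans with (1 := H3 N). rewrite <- (Rinv_inv eps).
      assert (0 < / eps) by now apply Rinv_0_lt_compat.
      apply Rlt_le, Rinv_lt_contravar; [|rewrite S_INR; lra].
      apply Rmult_lt_0_compat; [assumption|]. rewrite S_INR. lra.
  - intros x Ax m. now apply Hc.
Qed.

Theorem theorem3p4 (n : nat) (hn : (0 < n)%nat) (hstar : star_hyp n) :
  exists A : Rn n -> Prop,
    ~ lebesgue_null A /\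
    forall f : Rn n -> R, continuous_Rn f -> ~ image_contains_interval f A.
Proof.
  assert (Htask : cont_many
    ({f : Rn n -> R | continuous_Rn f} * (R * R) * (nat -> nat -> Rn n * Rn n))).
  { repeat apply cont_many_prod; try exact cont_many_R.
    - apply cont_many_continuous.
    - apply cont_many_seq, cont_many_seq, cont_many_prod; apply cont_many_Rn. }
  destruct Htask as [task Htask].
  pose (f := fun a => proj1_sig (fst (fst (task a)))).
  pose (p := fun a => fst (snd (fst (task a)))).
  pose (q := fun a => snd (snd (fst (task a)))).
  pose (N := fun a => cover_inter (snd (task a))).
  assert (Hf : forall a, continuous_Rn (f a)) by (intros a; exact (proj2_sig (fst (fst (task a))))).
  destruct (exists_initial_well_order K) as [lt [Hwf [Htri Hseg]]].
  pose (null_level := fun a y => lebesgue_null (fun x : Rn n => f a x = y)).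
  (* The value at [a] is the pair of the point and the forbidden level. Codes whose [N a] is not
     null, or whose interval is degenerate, leave the corresponding clause void. *)
  destruct (wf_choice_recursion K (Rn n * R) (fun _ => 0, 0) lt Hwf (fun a g xy =>
    (lebesgue_null (N a) -> ~ N a (fst xy)) /\
    (forall b, lt b a -> null_level b (snd (g b)) -> f b (fst xy) <> snd (g b)) /\
    (p a < q a -> p a <= snd xy <= q a /\ null_level a (snd xy) /\ f a (fst xy) <> snd xy /\
      forall b, lt b a -> f a (fst (g b)) <> snd xy))) as [g Hg].
  { intros a g g' xy E [H1 [H2 H3]]. split; [exact H1 | split].
    - intros b Hb. rewrite <- (E b Hb). now apply H2.
    - intros Hpq. destruct (H3 Hpq) as [H4 [H5 [H6 H7]]].
      split; [exact H4 | split; [exact H5 | split; [exact H6|]]].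
      intros b Hb. rewrite <- (E b Hb). now apply H7. }
  { intros a g.
    pose (level := fun b x => f b x = snd (g b)).
    assert (Hx : exists x, (lebesgue_null (N a) -> ~ N a x) /\
      forall b, lt b a -> null_level b (snd (g b)) -> f b x <> snd (g b)).
    { destruct (hstar (fun S => (exists b, lt b a /\ S = level b) /\ lebesgue_null S)
        (fun x => N a x /\ lebesgue_null (N a))) as [x [Hx1 Hx2]].
      - intros S [[b [_ ->]] HS]. split; [|exact HS]. apply level_closed, Hf.
      - apply (card_lt_segment_image lt a _ level (Hseg a)). now intros S [HS _].
      - destruct (classic (lebesgue_null (N a))) as [H | H].
        + intros eps Heps. destruct (H eps Heps) as [u [v [H1 [H2 H3]]]].
          exists u, v. split; [exact H1 | split; [|exact H3]]. intros x [Hx _]. now apply H2.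
        + intros eps Heps. exists (fun _ _ => 0), (fun _ _ => 0). split; [|split].
          * intros; lra.
          * intros x [_ Hx]. contradiction.
          * intros m. rewrite sum_f_R0_sumR, sumR_const.
            replace (box_vol (fun _ : Fin.t n => 0) (fun _ => 0)) with 0; [lra|].
            destruct n as [|n']; [lia|]. unfold box_vol. simpl. ring.
      - exists x. split.
        + intros HN Hx. now apply Hx1.
        + intros b Hb Hlev. apply (Hx2 (level b)). split; [now exists b | exact Hlev]. }
    destruct Hx as [x [Hx1 Hx2]].
    destruct (Rlt_dec (p a) (q a)) as [Hpq | Hpq].
    - destruct (non_null_levels_countable n (f a) hn (Hf a)) as [e He].
      (* Slot 0 of the countable list holds [f a x], so the new level also avoids the point just
         chosen. *)
      destruct (exists_value_avoiding lt a (fun k => match k with O => f a x | S k => e k end)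
        (fun b => f a (fst (g b))) (p a) (q a) (Hseg a) Hpq) as [y [Hy1 [Hy2 Hy3]]].
      exists (x, y). split; [exact Hx1 | split; [exact Hx2|]]. intros _.
      split; [exact Hy1 | split; [|split; [exact (Hy2 O) | exact Hy3]]].
      apply NNPP. intros Hlev. destruct (He y Hlev) as [k Hk]. exact (Hy2 (S k) Hk).
    - exists (x, 0). split; [exact Hx1 | split; [exact Hx2|]]. contradiction. }
  exists (fun x => exists a, x = fst (g a)). split.
  - intros HA. destruct (null_in_cover_inter n _ HA) as [c [Hc HAc]].
    (* Any continuous function and interval complete the hull [c] to a task; the point chosen for
       that task lies in the set but outside the hull. *)
    destruct (cont_many_continuous n) as [s _].
    destruct (Htask (s (fun _ => true), (0, 1), c)) as [a Ha].
    assert (HN : N a = cover_inter c) by (unfold N; now rewrite Ha).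
    destruct (Hg a) as [H1 _]. rewrite HN in H1. apply (H1 Hc), HAc. now exists a.
  - intros f0 Hf0 [p0 [q0 [Hpq Himg]]].
    destruct (Htask (exist _ f0 Hf0, (p0, q0), fun _ _ => (fun _ => 0, fun _ => 0))) as [a Ha].
    assert (Efa : f a = f0) by (unfold f; now rewrite Ha).
    assert (Epa : p a = p0) by (unfold p; now rewrite Ha).
    assert (Eqa : q a = q0) by (unfold q; now rewrite Ha).
    destruct (Hg a) as [_ [_ H3]]. rewrite Epa, Eqa in H3.
    destruct (H3 Hpq) as [Hy [Hnull [Haa Hab]]].
    destruct (Himg _ Hy) as [x [[b ->] E]]. rewrite <- Efa in E.
    (* Earlier points and the point at [a] were avoided when the level at [a] was chosen; later
       points were chosen outside that null level set. *)
    destruct (Htri b a) as [H | [-> | H]].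
    + exact (Hab b H E).
    + exact (Haa E).
    + exact (proj1 (proj2 (Hg b)) a H Hnull E).
Qed.
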